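(* Let $K$ be a finite simplicial complex and let $\mathcal{F}=(K_t)_{t\in T}$ denote a filtration of $K$. Suppose $p\ge 0$ and let $b=(s,t,1)\in\mathbf{B}_p(\mathcal{F})$ be a simple bar. Let $z_0$ be a harmonic representative of $b$. Then for any $z\in\mathrm{Rep}(b)$, $$\mathrm{content}(z)\le\mathrm{content}(z_0).$$
   Context: A finite simplicial complex $K$ is a set of (nonempty) subsets of $\{0,\dots,M\}$ for some $M$, closed under passing to (nonempty) subsets; $K^{[p]}$ is the set of its $p$-dimensional simplices. $C_p(K)$ is the real vector space with basis $K^{[p]}$, with the inner product making $K^{[p]}$ an orthonormal basis; $\partial_p$ is the usual boundary map ($\partial_0=0$), $Z_p(K)=\ker\partial_p$, $B_p(K)=\mathrm{Im}\,\partial_{p+1}$, $H_p(K)=Z_p(K)/B_p(K)$, $\mathcal{H}_p(K)=Z_p(K)\cap B_p(K)^\perp$. For a sub-complex $K'\subset K$, $C_p(K')\subset C_p(K)$. A filtration $\mathcal{F}=(K_t)_{t\in T}$ of $K$ is a family of sub-complexes of $K$ indexed by a (totally) ordered set $T$ with $K_s\subset K_t$ for $s\le t$. Convention: if $T$ has end points $\min T,\max T$, one formally adjoins $\pm\infty$ with $K_{-\infty}=\emptyset$ and $K_\infty=K_{\max T}$ (so indices $s'<\min T$ in the sums below are allowed). For $s\le t$, $i_p^{s,t}:H_p(K_s)\to H_p(K_t)$ is induced by inclusion and $H_p^{s,t}(\mathcal{F})=\mathrm{Im}(i_p^{s,t})$. Define subspaces of $H_p(K_s)$: $$M_p^{s,t}(\mathcal{F})=\sum_{s'<s}(i_p^{s,t})^{-1}(H_p^{s',t}(\mathcal{F})),\quad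 M_p^{s,\infty}(\mathcal{F})=\sum_{s\le t'}M_p^{s,t'}(\mathcal{F}),\quad N_p^{s,t}(\mathcal{F})=\sum_{s'<s\le t'<t}(i_p^{s,t'})^{-1}(H_p^{s',t'}(\mathcal{F})).$$ For $s<t$, $P_p^{s,t}(\mathcal{F})=M_p^{s,t}(\mathcal{F})/N_p^{s,t}(\mathcal{F})$, and $P_p^{s,\infty}(\mathcal{F})=H_p(K_s)/M_p^{s,\infty}(\mathcal{F})$. Put $\mu_p^{s,t}(\mathcal{F})=\dim P_p^{s,t}(\mathcal{F})$ for $s\in T$, $t\in T\cup\{\infty\}$. The barcode is $\mathbf{B}_p(\mathcal{F})=\{(s,t,\mu_p^{s,t}(\mathcal{F}))\mid\mu_p^{s,t}(\mathcal{F})>0\}$; a bar is simple if $\mu_p^{s,t}(\mathcal{F})=1$. Harmonic versions: for $s\le t$, $\mathfrak{i}_p^{s,t}:\mathcal{H}_p(K_s)\to\mathcal{H}_p(K_t)$ is the restriction of the orthogonal projection $\mathrm{proj}_{B_p(K_t)^\perp}$, and $\mathcal{H}_p^{s,t}(\mathcal{F})=\mathrm{Im}(\mathfrak{i}_p^{s,t})$. Set $\mathcal{M}_p^{s,t}(\mathcal{F})=\sum_{s'<s}(\mathfrak{i}_p^{s,t})^{-1}(\mathcal{H}_p^{s',t}(\mathcal{F}))$, and for $s<t$, $\mathcal{N}_p^{s,t}(\mathcal{F})=\sum_{s'<s\le t'<t}(\mathfrak{i}_p^{s,t'})^{-1}(\mathcal{H}_p^{s',t'}(\mathcal{F}))$,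 $\mathcal{P}_p^{s,t}(\mathcal{F})=\mathcal{M}_p^{s,t}(\mathcal{F})\cap\mathcal{N}_p^{s,t}(\mathcal{F})^\perp$, and $\mathcal{P}_p^{s,\infty}(\mathcal{F})=\mathcal{H}_p(K_s)\cap\bigcap_{s\le t}\mathcal{M}_p^{s,t}(\mathcal{F})^\perp$. A harmonic representative of a simple bar $(s,t,1)$ is any non-zero cycle in $\mathcal{P}_p^{s,t}(\mathcal{F})$. Let $\phi_p^s:Z_p(K_s)\to H_p(K_s)$ be the canonical surjection, $\widetilde{M}_p^{s,t}(\mathcal{F})=(\phi_p^s)^{-1}(M_p^{s,t}(\mathcal{F}))$, $\widetilde{N}_p^{s,t}(\mathcal{F})=(\phi_p^s)^{-1}(N_p^{s,t}(\mathcal{F}))$ for $s<t$, and $\widetilde{M}_p^{s,\infty}(\mathcal{F})=\bigcup_{s\le t}(\phi_p^s)^{-1}(M_p^{s,t}(\mathcal{F}))$. For a simple bar $b=(s,t,1)$, the set of cycles representing $b$ is $\mathrm{Rep}(b)=Z_p(K_s)\setminus\widetilde{M}_p^{s,\infty}(\mathcal{F})$ if $t=\infty$, and $\mathrm{Rep}(b)=\widetilde{M}_p^{s,t}(\mathcal{F})\setminus\widetilde{N}_p^{s,t}(\mathcal{F})$ otherwise. For $z=\sum_{\sigma\in K^{[p]}}c_\sigma\sigma$, $\mathrm{supp}(z)=\{\sigma\mid c_\sigma\ne 0\}$. The set of essential simplices of $b$ is $\Sigma(b)=\bigcap_{z\in\mathrm{Rep}(b)}\mathrm{supp}(z)$.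 The relative essential content of $z=\sum_\sigma c_\sigma\sigma\in\mathrm{Rep}(b)$ is $$\mathrm{content}(z)=\left(\frac{\sum_{\sigma\in\Sigma(b)}c_\sigma^2}{\sum_{\sigma\in K^{[p]}}c_\sigma^2}\right)^{1/2}.$$ *)

(* Defs.v *)
From HB Require Import structures.
From mathcomp Require Import all_boot all_order all_algebra.
From mathcomp Require Import ring_quotient sesquilinear.
From mathcomp Require Import boolp classical_sets reals.

Set Implicit Arguments.
Unset Strict Implicit.
Unset Printing Implicit Defensive.

Import Order.TTheory GRing.Theory Num.Theory.
Import Quotient.Exports VectorInternalTheory.
Local Open Scope ring_scope.

(* [vquot B] is the group of cosets V/B of ring_quotient, equipped with its
   vector space structure. *)
Section VectorQuotient.
Variables (F : fieldType) (V : vectType F).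

Definition vquot (B : {vspace V}) : Type := Quotient.quot B.

Section Structure.
Variable B : {vspace V}.

HB.instance Definition _ := GRing.Zmodule.on (vquot B).

Definition vpi : V -> vquot B := \pi_(Quotient.quot B)%qT.

Lemma vpi_surj (x : vquot B) : {v | vpi v = x}.
Proof. by exists (repr x); rewrite /vpi reprK. Qed.

Lemma vpi_eq v w : (vpi v == vpi w) = (v - w \in B).
Proof. by rewrite /vpi -Quotient.idealrBE. Qed.

Lemma vpiD v w : vpi (v + w) = vpi v + vpi w.
Proof. exact: (raddfD (\pi_(Quotient.quot B)%qT)). Qed.

Definition vquot_scale (a : F) (x : vquot B) : vquot B := vpi (a *: repr x).

Lemma vpiZ a v : vpi (a *: v) = vquot_scale a (vpi v).
Proof.
apply/eqP; rewrite /vquot_scale vpi_eq -scalerBr rpredZ // -vpi_eq.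
by rewrite {2}/vpi reprK.
Qed.

Fact vquot_scaleA a b x :
  vquot_scale a (vquot_scale b x) = vquot_scale (a * b) x.
Proof. by case: (vpi_surj x) => v <-; rewrite -!vpiZ scalerA. Qed.

Fact vquot_scale1 : left_id 1 vquot_scale.
Proof. by move=> x; case: (vpi_surj x) => v <-; rewrite -vpiZ scale1r. Qed.

Fact vquot_scaleDr : right_distributive vquot_scale +%R.
Proof.
move=> a x y; case: (vpi_surj x) => v <-; case: (vpi_surj y) => w <-.
by rewrite -vpiD -!vpiZ scalerDr vpiD.
Qed.

Fact vquot_scaleDl x : {morph vquot_scale^~ x : a b / a + b}.
Proof.
by move=> a b; case: (vpi_surj x) => v <-; rewrite -!vpiZ scalerDl vpiD.
Qed.

HB.instance Definition _ := GRing.Zmodule_isLmodule.Build F (vquot B)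
  vquot_scaleA vquot_scale1 vquot_scaleDr vquot_scaleDl.

Fact vpi_linear : linear vpi.
Proof. by move=> a v w; rewrite vpiD vpiZ. Qed.

HB.instance Definition _ := GRing.isLinear.Build F V (vquot B) _ vpi vpi_linear.

Fact vquot_vect_iso : Vector.axiom (dim (subvs_of (B^C)%VS)) (vquot B).
Proof.
have tB : (B^C :&: B = 0)%VS by rewrite capvC capv_compl.
pose q v := vsproj (B^C)%VS (daddv_pi (B^C)%VS B v).
have q0 v w : v - w \in B -> q v = q w.
  move=> vwB; apply/eqP; rewrite /q -subr_eq0 -!linearB /=.
  have := daddv_pi_add tB (_ : v - w \in _).
  rewrite addvC addv_complf memvf => /(_ isT).
  rewrite (daddv_pi_id _ vwB) ?capv_compl // => /(canRL (addrK _)).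
  by rewrite subrr => ->; rewrite linear0.
have qE v : q (repr (vpi v)) = q v.
  by apply: q0; rewrite -vpi_eq {1}/vpi reprK.
exists (fun x => v2r (q (repr x))).
  move=> a x y; case: (vpi_surj x) => v <-; case: (vpi_surj y) => w <-.
  have -> : a *: vpi v + vpi w = vpi (a *: v + w) by rewrite linearP.
  by rewrite !qE /q !linearP.
exists (fun r => vpi (vsval (r2v r : subvs_of (B^C)%VS))) => [x|r].
  rewrite v2rK; case: (vpi_surj x) => v <-; rewrite qE.
  apply/eqP; rewrite vpi_eq /q vsprojK ?memv_pi //.
  have vE := daddv_pi_add tB (_ : v \in _).
  rewrite addvC addv_complf memvf in vE.
  by rewrite -{2}(vE isT) opprD addrA subrr add0r memvN memv_pi.
by rewrite qE /q daddv_pi_id ?subvsP // vsvalK r2vK.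
Qed.

HB.instance Definition _ :=
  Lmodule_hasFinDim.Build F (vquot B) vquot_vect_iso.

End Structure.
End VectorQuotient.

Section Subspaces.
Variables (F : fieldType) (V : vectType F).

(* The quotient A/B of subspaces of V. It makes sense without B <= A, in which
   case it is A/(A :&: B). *)
Definition subquo (A B : {vspace V}) : vectType F :=
  vquot (linfun (vsval : subvs_of A -> V) @^-1: B)%VS.

Definition subquo_pi (A B : {vspace V}) : 'Hom(subvs_of A, subquo A B) :=
  linfun (vpi (linfun (vsval : subvs_of A -> V) @^-1: B)%VS).

Lemma subquo_pi_surj A B x : exists v, subquo_pi A B v = x.
Proof. by case: (vpi_surj x) => v <-; exists v; rewrite lfunE. Qed.

Lemma subquo_pi_eq A B v w :
  (subquo_pi A B v == subquo_pi A B w) = (vsval v - vsval w \in B).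
Proof. by rewrite !lfunE vpi_eq -memv_preim lfunE. Qed.

(* The sum of an arbitrary, possibly infinite, family of subspaces: the set of
   all finite sums of vectors taken from members of the family. *)
Definition is_vsum (I : Type) (A : I -> {vspace V}) (U : {vspace V}) : Prop :=
  forall v, v \in U <-> exists r : seq I, v \in (\sum_(i <- r) A i)%VS.

Definition vsum (I : Type) (A : I -> {vspace V}) : {vspace V} :=
  xget 0%VS [set U | is_vsum A U]%classic.

Lemma vsumP (I : Type) (A : I -> {vspace V}) : is_vsum A (vsum A).
Proof.
rewrite /vsum; case: xgetP => [U _ //|] /= noU.
pose D n := `[< exists r : seq I, \dim (\sum_(i <- r) A i)%VS = n >].
have D0 : exists n, D n.
  by exists (\dim (\sum_(i <- [::]) A i)%VS); apply/asboolP; exists [::].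
have Dle n : D n -> (n <= \dim {:V})%N.
  by move=> /asboolP [r <-]; rewrite dimvS ?subvf.
case: (ex_maxnP D0 Dle) => n /asboolP [r rn] nmax.
case: (noU (\sum_(i <- r) A i)%VS) => v; split=> [vr|[r' vr']]; first by exists r.
have sub : (\sum_(i <- r) A i <= \sum_(i <- r ++ r') A i)%VS.
  by rewrite big_cat addvSl.
have /eqP -> : (\sum_(i <- r) A i)%VS == (\sum_(i <- r ++ r') A i)%VS.
  rewrite eqEdim sub rn; apply: nmax; apply/asboolP; by exists (r ++ r').
by rewrite big_cat; apply: subvP vr'; rewrite addvSr.
Qed.

End Subspaces.

Section Simplices.
Variable m : nat.
Implicit Types (K : {set {set 'I_m.+1}}) (p : nat).

Definition simplicial_complex K : Prop :=
  finset.set0 \notin K /\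
  forall s t : {set 'I_m.+1},
    s \in K -> t \subset s -> t != finset.set0 -> t \in K.

Definition simplices p K : {set {set 'I_m.+1}} :=
  [set s in K | #|s| == p.+1]%SET.

End Simplices.

Section Homology.
Variables (R : realType) (m : nat).
Implicit Types (K : {set {set 'I_m.+1}}) (p : nat).

(* All the spaces C_p(K) are realised inside one ambient space with basis the
   subsets of {0, ..., m}, so that C_p(K') is a subspace of C_p(K) for a
   sub-complex K' of K. *)
Definition chain : vectType R := {ffun {set 'I_m.+1} -> R^o}.

Definition elem (s : {set 'I_m.+1}) : chain := [ffun t => (t == s)%:R].

Definition dotp (u v : chain) : R := \sum_s u s * v s.

Definition Cp p K : {vspace chain} := (\sum_(s in simplices p K) <[elem s]>)%VS.

Fact dotp_bilinear : bilinear_for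
  (GRing.Scale.Law.clone _ _ *%R _) (GRing.Scale.Law.clone _ _ (idfun \; *%R) _)
  dotp.
Proof.
split=> w a u v; rewrite /dotp /= mulr_sumr -big_split /=;
  apply: eq_bigr => s _; rewrite !ffunE /=.
  by rewrite mulrDl mulrA.
by rewrite mulrDr mulrCA.
Qed.

HB.instance Definition _ :=
  bilinear_isBilinear.Build R chain chain R _ _ dotp dotp_bilinear.

Fact dotp_hermitian u v : dotp u v = (-1) ^+ false * idfun (dotp v u).
Proof. by rewrite expr0 mul1r; apply: eq_bigr => s _; rewrite mulrC. Qed.

HB.instance Definition _ :=
  isHermitianSesquilinear.Build R chain false idfun dotp dotp_hermitian.

Fact dotp_gt0 u : u != 0 -> 0 < dotp u u.
Proof.
move=> u0; rewrite lt_def sumr_ge0 => [|s _]; last by rewrite -expr2 sqr_ge0.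
rewrite andbT; apply: contra u0; rewrite psumr_eq0 => [/allP uE|s _].
  apply/eqP/ffunP => s; rewrite ffunE; apply/eqP.
  by have := uE s (mem_index_enum s); rewrite mulf_eq0 orbb.
by rewrite -expr2 sqr_ge0.
Qed.

HB.instance Definition _ := isDotProduct.Build R chain dotp dotp_gt0.

(* The complement is taken in the ambient space. Its intersections with subspaces
   of C_p(K), and the projection along U restricted to C_p(K) for U <= C_p(K),
   are the same as for the complement taken in C_p(K). *)
Definition perp (U : {vspace chain}) : {vspace chain} := orthov dotp U.

Definition proj_perp (U : {vspace chain}) : 'End(chain) := daddv_pi (perp U) U.

(* Simplices are oriented by the order of their vertices: the sign of the facet
   opposite to v is given by the position of v among the vertices. *)
Definition bdry_elem p (s : {set 'I_m.+1}) : chain :=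
  if p is 0 then 0 else
  \sum_(v in s) (-1) ^+ #|[set u in s | (u < v)%N]%SET| *: elem (s :\ v)%SET.

Definition bdry_fun p (c : chain) : chain :=
  \sum_(s : {set 'I_m.+1} | #|s| == p.+1) c s *: bdry_elem p s.

Fact bdry_fun_linear p : linear (bdry_fun p).
Proof.
move=> a u v; rewrite /bdry_fun scaler_sumr -big_split /=.
by apply: eq_bigr => s _; rewrite !ffunE scalerDl scalerA.
Qed.

HB.instance Definition _ p :=
  GRing.isLinear.Build R chain chain _ (bdry_fun p) (bdry_fun_linear p).

Definition bdry p : 'End(chain) := linfun (bdry_fun p).

Definition Zp p K : {vspace chain} := (Cp p K :&: lker (bdry p))%VS.
Definition Bp p K : {vspace chain} := (bdry p.+1 @: Cp p.+1 K)%VS.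

Definition Hp p K : vectType R := subquo (Zp p K) (Bp p K).

Definition cls p K : 'Hom(subvs_of (Zp p K), Hp p K) :=
  subquo_pi (Zp p K) (Bp p K).

Lemma cls_eq p K v w : (cls p K v == cls p K w) = (vsval v - vsval w \in Bp p K).
Proof. exact: subquo_pi_eq. Qed.

(* The map induced by an inclusion K' <= K, see [imapE]: a class is sent to the
   class in K of any of its representatives. *)
Definition imap p K' K : 'Hom(Hp p K', Hp p K) :=
  (cls p K \o linfun (vsproj (Zp p K) \o @vsval _ _ (Zp p K')) \o
   (cls p K')^-1)%VF.

Lemma Cp_sub p K' K : K' \subset K -> (Cp p K' <= Cp p K)%VS.
Proof.
move=> sK; apply/subv_sumP => s; rewrite inE => /andP [sK' cs].
by apply: (sumv_sup s) => //; rewrite inE cs (fintype.subsetP sK).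
Qed.

Lemma imapE p K' K (z' : subvs_of (Zp p K')) (z : subvs_of (Zp p K)) :
  K' \subset K -> vsval z = vsval z' -> imap p K' K (cls p K' z') = cls p K z.
Proof.
move=> sK zz'; rewrite /imap !comp_lfunE.
set w := ((cls p K')^-1)%VF _.
have ZS : (Zp p K' <= Zp p K)%VS by rewrite capvS // Cp_sub.
have wz' : vsval w - vsval z' \in Bp p K'.
  rewrite -cls_eq; apply/eqP.
  apply: (@limg_lfunVK _ _ _ (cls p K')); exact: memv_img (memvf _).
apply/eqP; rewrite cls_eq lfunE /= vsprojK ?(subvP ZS) ?subvsP // zz'.
by apply: subvP wz'; rewrite limgS // Cp_sub.
Qed.

Definition harm p K : {vspace chain} := (Zp p K :&: perp (Bp p K))%VS.

Definition supp p K (z : chain) : {set {set 'I_m.+1}} :=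
  [set s in simplices p K | z s != 0]%SET.

End Homology.

Section Filtration.
Variables (m : nat) (K : {set {set 'I_m.+1}}).
Variables (d : Order.disp_t) (T : orderType d).

Record filtration := Filtration {
  fsub :> T -> {set {set 'I_m.+1}};
  fsub_complex : forall t, simplicial_complex (fsub t);
  fsub_sub : forall t, fsub t \subset K;
  fsub_mono : forall s t, (s <= t)%O -> fsub s \subset fsub t
}.

(* An element of [option T] used as the beginning s' of an interval stands for
   an element of T with a least element -oo = None adjoined, where the
   sub-complex is empty. It is adjoined whether or not T has a least element:
   if T has none this does not change M and N, since the term with s' = -oo is
   the kernel of a map and is contained in all the terms with s' in T. *)
Definition fsubx (F : filtration) (s' : option T) : {set {set 'I_m.+1}} :=
  if s' is Some s0 then F s0 else finset.set0.

Definition ltx (s' : option T) (s : T) : bool :=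
  if s' is Some s0 then (s0 < s)%O else true.

(* As the end of a bar, None stands for +oo. *)
Definition lt_end (s : T) (t : option T) : bool :=
  if t is Some t0 then (s < t0)%O else true.

Variables (R : realType) (F : filtration) (p : nat).
Local Notation chain := (chain R m).
Local Notation i_ s t := (imap R p (F s) (F t)).
Local Notation Z_ s := (Zp R p (F s)).

Definition Him (s' : option T) (t : T) : {vspace Hp R p (F t)} :=
  limg (imap R p (fsubx F s') (F t)).

Definition M_ (s t : T) : {vspace Hp R p (F s)} :=
  vsum (fun s' : {s' : option T | ltx s' s} =>
    (i_ s t @^-1: Him (sval s') t)%VS).

Definition Moo (s : T) : {vspace Hp R p (F s)} :=
  vsum (fun t' : {t' : T | (s <= t')%O} => M_ s (sval t')).

Definition N_ (s t : T) : {vspace Hp R p (F s)} :=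
  vsum (fun x : {x : option T * T | [&& ltx x.1 s, (s <= x.2)%O & (x.2 < t)%O]} =>
    (i_ s (sval x).2 @^-1: Him (sval x).1 (sval x).2)%VS).

Definition P_ (s : T) (t : option T) : vectType R :=
  if t is Some t0 then subquo (M_ s t0) (N_ s t0) else vquot (Moo s).

Definition mu (s : T) (t : option T) : nat := \dim {: P_ s t}.

Definition barcode : set (T * option T * nat) :=
  [set b | exists s t,
     [/\ lt_end s t, (0 < mu s t)%N & b = (s, t, mu s t)]]%classic.

(* The harmonic map is [hproj t] restricted to the harmonic space of K_s, whence
   the intersection with [harm R p (F s)] in preimages. *)
Definition hproj (t : T) : 'End(chain) := proj_perp (Bp R p (F t)).

Definition hHim (s' : option T) (t : T) : {vspace chain} :=
  (hproj t @: harm R p (fsubx F s'))%VS.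

Definition hpre (s t : T) (U : {vspace chain}) : {vspace chain} :=
  (harm R p (F s) :&: (hproj t @^-1: U))%VS.

Definition hM (s t : T) : {vspace chain} :=
  vsum (fun s' : {s' : option T | ltx s' s} => hpre s t (hHim (sval s') t)).

Definition hN (s t : T) : {vspace chain} :=
  vsum (fun x : {x : option T * T | [&& ltx x.1 s, (s <= x.2)%O & (x.2 < t)%O]} =>
    hpre s (sval x).2 (hHim (sval x).1 (sval x).2)).

Definition hP (s : T) (t : option T) : set chain :=
  if t is Some t0 then [set` (hM s t0 :&: perp (hN s t0))%VS]%classic
  else ([set` harm R p (F s)] `&`
        \bigcap_(t' in [set t' | (s <= t')%O]) [set` perp (hM s t')])%classic.

Definition harmonic_rep (s : T) (t : option T) (z : chain) : Prop :=
  z != 0 /\ hP s t z.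

Definition cycles_of (s : T) (U : {vspace Hp R p (F s)}) : set chain :=
  (vsval @` (cls R p (F s) @^-1` [set` U]))%classic.

Definition tM (s t : T) : set chain := cycles_of (M_ s t).
Definition tN (s t : T) : set chain := cycles_of (N_ s t).
Definition tMoo (s : T) : set chain :=
  (\bigcup_(t in [set t | (s <= t)%O]) tM s t)%classic.

Definition Rep (s : T) (t : option T) : set chain :=
  if t is Some t0 then (tM s t0 `\` tN s t0)%classic
  else ([set` Z_ s] `\` tMoo s)%classic.

Definition essential (s : T) (t : option T) : {set {set 'I_m.+1}} :=
  [set x in simplices p K | `[< forall z, Rep s t z -> x \in supp p K z >]]%SET.

Definition content (s : T) (t : option T) (z : chain) : R :=
  Num.sqrt ((\sum_(x in essential s t) z x ^+ 2) /
            (\sum_(x in simplices p K) z x ^+ 2)).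

End Filtration.

(* Main.v *)
Require Import Defs.
From mathcomp Require Import all_boot all_order all_algebra.
From mathcomp Require Import sesquilinear.
From mathcomp Require Import boolp.
From mathcomp Require Import classical_sets reals.

Local Open Scope ring_scope.
Set Implicit Arguments.
Unset Strict Implicit.
Unset Printing Implicit Defensive.
Import Order.TTheory GRing.Theory Num.Theory.

(** The argument takes place in the cycles of K_s. Classes of cycles carry two
    subspaces N and A such that the representatives of the bar are the cycles
    with class in A but not in N: they are N^(s,t) and M^(s,t) for a finite bar,
    M^(s,oo) and the whole of H_p(K_s) for an infinite one. Simplicity of the bar
    says that N has codimension one in A. A harmonic representative z0 has its
    class in A and is orthogonal to every cycle with class in N, hence, being
    nonzero, it represents the bar itself. By codimension one a representative z
    is k z0 + y, where y has its class in N, so that y is orthogonal to z0.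

    Such a y vanishes on every essential simplex: otherwise subtracting a
    suitable multiple of y from z0 would kill the coefficient of that simplex and
    still leave a representative. Thus z and k z0 agree on the essential
    simplices, while |z|^2 = k^2 |z0|^2 + |y|^2 by Pythagoras, and the content of
    z is at most that of z0 ([content_le_rep]).

    What remains is to move between the harmonic spaces, where z0 is given, and
    homology, where the representatives are. The bridge is the Hodge isomorphism
    [hodge] from H_p(K) onto the harmonic space of K, sending a class to the
    projection of any of its cycles along the boundaries. It intertwines the map
    induced by an inclusion with the orthogonal projection defining its harmonic
    counterpart ([hodge_imap]), so it carries M and N onto their harmonic
    versions ([hodge_M], [hodge_N]). That its image consists of cycles rests on
    the boundary of a boundary being zero ([Bp_sub_Zp]). *)

(** * Linear algebra *)

Section LinearAlgebra.
Variables (F : fieldType) (V W : vectType F).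

Lemma memv_limg_inj (f : 'Hom(V, W)) (U : {vspace V}) v :
  injective f -> (f v \in (f @: U)%VS) = (v \in U).
Proof.
move=> f_inj; apply/idP/idP => [/memv_imgP[u uU /f_inj ->] //|].
exact: memv_img.
Qed.

(** By finite dimension [vsum] is a single subspace even for an infinite family,
    but its elements still come from finite subfamilies, over which images
    commute with sums. *)
Lemma limg_vsum (f : 'Hom(V, W)) (I : Type) (A : I -> {vspace V}) :
  (f @: vsum A)%VS = vsum (fun i => f @: A i)%VS.
Proof.
have limg_bigsum (r : seq I) :
    (f @: (\sum_(i <- r) A i) = \sum_(i <- r) f @: A i)%VS.
  exact: (big_morph _ (limgD f) (limg0 f)).
apply/vspaceP => w; apply/memv_imgP/idP.
  move=> [v /vsumP[r vr] ->]; apply/vsumP; exists r.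
  by rewrite -limg_bigsum memv_img.
move=> /vsumP[r]; rewrite -limg_bigsum => /memv_imgP[v vr ->].
by exists v => //; apply/vsumP; exists r.
Qed.

Lemma vsum_sub (I : Type) (A : I -> {vspace V}) (U : {vspace V}) :
  (forall i, (A i <= U)%VS) -> (vsum A <= U)%VS.
Proof.
move=> AU; apply/subvP => v /vsumP[r]; apply: subvP.
by elim/big_ind: _ => // [|X Y XU YU]; rewrite ?sub0v // subv_add XU.
Qed.

Lemma memv_vsum (I : Type) (A : I -> {vspace V}) i v : v \in A i -> v \in vsum A.
Proof. by move=> vA; apply/vsumP; exists [:: i]; rewrite big_seq1. Qed.

Lemma dim1_scale (x y : V) :
  \dim {:V} = 1%N -> x != 0 -> exists k, y = k *: x.
Proof.
move=> dimV x0; apply/vlineP.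
suff -> : (<[x]> = fullv)%VS by rewrite memvf.
by apply/eqP; rewrite eqEdim subvf dim_vline x0 dimV.
Qed.

End LinearAlgebra.

Lemma vquot_dim1 (F : fieldType) (V : vectType F) (B : {vspace V}) u v :
  \dim {:vquot B} = 1%N -> v \notin B -> exists k, u - k *: v \in B.
Proof.
move=> dimQ vB; have v0 : vpi B v != 0.
  by rewrite -(linear0 (vpi B)) vpi_eq subr0.
have [k /eqP] := dim1_scale (vpi B u) dimQ v0.
by rewrite -linearZ vpi_eq; exists k.
Qed.

Lemma subquo_dim1 (F : fieldType) (V : vectType F) (A B : {vspace V}) u v :
  \dim {:subquo A B} = 1%N -> u \in A -> v \in A -> v \notin B ->
  exists k, u - k *: v \in B.
Proof.
move=> dimQ uA vA vB.
have v0 : vsproj A v \notin (linfun (vsval : subvs_of A -> V) @^-1: B)%VS.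
  by rewrite -memv_preim lfunE /= vsprojK.
have [k] := vquot_dim1 (vsproj A u) dimQ v0.
by rewrite -memv_preim lfunE /= !vsprojK //; exists k.
Qed.

(** * Orthogonal projection of chains *)

Section OrthogonalProjection.
Variables (R : realType) (m : nat).
Implicit Types U : {vspace chain R m}.

Lemma dotpC (u v : chain R m) : dotp u v = dotp v u.
Proof. by apply: eq_bigr => x _; rewrite mulrC. Qed.

Lemma capv_perp U : (perp U :&: U = 0)%VS.
Proof.
apply/eqP; rewrite -subv0; apply/subvP => v.
rewrite memv_cap memv0 => /andP[/mem_orthovP vU /vU vv].
by apply: contra_eqT vv => /dotp_gt0 /lt0r_neq0.
Qed.

(** Each spanning vector imposes one linear condition on the orthogonal
    complement. *)
Lemma leq_codim_perp_span (us : seq (chain R m)) :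
  (\dim {:chain R m} <= \dim (perp <<us>>) + size us)%N.
Proof.
elim: us => [|u us IHus] /=.
  by rewrite span_nil /perp orthov0 addn0.
have -> : perp <<u :: us>> = (perp <<us>> :&: perp <[u]>)%VS.
  apply/vspaceP => v; rewrite memv_cap span_cons /perp !memvE orthovD.
  by rewrite andbC.
apply: (leq_trans IHus); rewrite addnS -addSn leq_add2r.
by rewrite -add1n -leq_subLR subn1 leq_dim_orthov1.
Qed.

(** The sum is direct by positivity of the inner product, so it is enough to
    bound the dimension of the complement from below. *)
Lemma addv_perp U : (perp U + U = fullv)%VS.
Proof.
apply/eqP; rewrite eqEdim subvf dimv_disjoint_sum ?capv_perp //=.
have := leq_codim_perp_span (vbasis U).
by rewrite (span_basis (vbasisP U)) size_tuple.
Qed.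

Lemma proj_perp_mem U v : proj_perp U v \in perp U.
Proof. exact: memv_pi. Qed.

Lemma sub_proj_perp U v : v - proj_perp U v \in U.
Proof.
have := daddv_pi_add (w := v) (capv_perp U).
rewrite addv_perp memvf => /(_ isT) vE.
by rewrite -{1}vE [X in X - _]addrC addrK memv_pi.
Qed.

Lemma proj_perp_id U v : v \in perp U -> proj_perp U v = v.
Proof. exact/daddv_pi_id/capv_perp. Qed.

Lemma proj_perp_eq0 U v : (proj_perp U v == 0) = (v \in U).
Proof.
apply/eqP/idP => [v0|vU].
  by have := sub_proj_perp U v; rewrite v0 subr0.
apply/eqP; rewrite -memv0 -(capv_perp U) memv_cap proj_perp_mem.
by rewrite -[X in X \in U](subKr v) memvB ?sub_proj_perp.
Qed.

Lemma dotp_proj_perp U u v : u \in perp U -> dotp u (proj_perp U v) = dotp u v.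
Proof.
move=> /mem_orthovP/(_ _ (sub_proj_perp U v)) /=.
by rewrite linearBr => /eqP; rewrite subr_eq0 => /eqP.
Qed.

End OrthogonalProjection.

(** * The boundary of a boundary is zero *)

Section BoundaryOfBoundary.
Variables (R : realType) (m : nat).
Implicit Types K : {set {set 'I_m.+1}}.

Lemma bdry_elemE p (s : {set 'I_m.+1}) :
  #|s| = p.+1 -> bdry R m p (elem R s) = bdry_elem R p s.
Proof.
move=> cs; rewrite lfunE /= /bdry_fun (bigD1 s) /= ?cs //.
rewrite ffunE eqxx scale1r big1 ?addr0 // => t /andP[_ /negPf ts].
by rewrite ffunE ts scale0r.
Qed.

Lemma card_facet p (s : {set 'I_m.+1}) v :
  #|s| = p.+1 -> v \in s -> #|s :\ v| = p.
Proof. by move=> + vs; rewrite (cardsD1 v) vs => -[]. Qed.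

(** Deleting v lowers by one the position of the vertices that come after v and
    keeps that of the others. *)
Lemma sign_face (s : {set 'I_m.+1}) v w : v \in s ->
  (-1) ^+ #|[set u in s :\ v | (u < w)%N]%SET| =
  (-1) ^+ (v < w)%N * (-1) ^+ #|[set u in s | (u < w)%N]%SET| :> R.
Proof.
move=> vs.
have -> : [set u in s :\ v | (u < w)%N]%SET =
          [set u in s | (u < w)%N]%SET :\ v.
  by apply/setP => u; rewrite !inE andbA.
by rewrite [in RHS](cardsD1 v) inE vs /= exprD mulrA -expr2 sqrr_sign mul1r.
Qed.

(** A face obtained by deleting two vertices v and w occurs twice, once for each
    order of deletion, with opposite signs. *)
Lemma bdry_bdry_elem p (s : {set 'I_m.+1}) :
  #|s| = p.+2 -> bdry R m p (bdry_elem R p.+1 s) = 0.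
Proof.
move=> cs; rewrite /= linear_sum /=.
have cf v : v \in s -> #|s :\ v| = p.+1.
  by move=> vs; exact: card_facet cs vs.
(* The boundary of a vertex is zero by convention, not by cancellation. *)
case: p cs cf => [|p] cs cf.
  by rewrite big1 // => v vs; rewrite linearZ /= bdry_elemE ?cf // scaler0.
pose e (v : 'I_m.+1) : R := (-1) ^+ #|[set u in s | (u < v)%N]%SET|.
pose f (v w : 'I_m.+1) : chain R m :=
  ((-1) ^+ (v < w)%N * (e v * e w)) *: elem R (s :\ v :\ w).
have -> : \sum_(v in s) bdry R m p.+1 (e v *: elem R (s :\ v)) =
    \sum_(v in s) \sum_(w in s | w != v) f v w.
  apply: eq_bigr => v vs; rewrite linearZ /= bdry_elemE ?cf //= scaler_sumr.
  apply: eq_big => w; first by rewrite !inE andbC.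
  move=> _; rewrite sign_face // scalerA /f /e; congr (_ *: _).
  by rewrite mulrCA.
have fC v w : w != v -> f w v = - f v w.
  move=> wv; rewrite /f -scaleNr [e w * _]mulrC -mulNr.
  have -> : s :\ w :\ v = s :\ v :\ w.
    by apply/setP => u; rewrite !inE andbCA.
  congr (_ * _ *: _); case: ltngtP wv => //; rewrite ?expr0 ?expr1 ?opprK //.
  by move/val_inj->; rewrite eqxx.
set S := (X in X = 0).
(* S is shown equal to its opposite by exchanging the two deletions. *)
suff : S = - S.
  move=> /eqP; rewrite -addr_eq0 -mulr2n -scaler_nat scaler_eq0 pnatr_eq0.
  by move=> /eqP.
rewrite {1}/S (exchange_big_dep (mem s)) /=; last by move=> ? ? _ /andP[].
rewrite /S -sumrN; apply: eq_bigr => w ws; rewrite -sumrN.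
apply: eq_big => v; first by rewrite ws [w == v]eq_sym.
by move=> /and3P[_ _ /fC->]; rewrite opprK.
Qed.

Lemma Bp_sub_Zp p K : simplicial_complex K -> (Bp R p K <= Defs.Zp R p K)%VS.
Proof.
move=> [_ Kdown]; rewrite /Bp limg_sum; apply/subv_sumP => s.
rewrite inE => /andP[sK /eqP cs]; rewrite limg_line -memvE memv_cap memv_ker.
rewrite bdry_elemE // bdry_bdry_elem // eqxx andbT /=.
apply: memv_suml => v vs; rewrite memvZ //.
have cf : #|s :\ v| == p.+1 by apply/eqP; exact: card_facet cs vs.
rewrite memvE (sumv_sup (s :\ v)%SET) // inE cf andbT.
by rewrite (Kdown s) ?subD1set // -card_gt0 (eqP cf).
Qed.

End BoundaryOfBoundary.

(** * The Hodge isomorphism *)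

Section Hodge.
Variables (R : realType) (m p : nat).
Implicit Types K : {set {set 'I_m.+1}}.
Local Notation Z_ K := (Defs.Zp R p K).
Local Notation B_ K := (Bp R p K).

(** The partial inverse of [cls] selects some cycle in each class. Cycles of one
    class differ by a boundary, which the projection kills, so the value is that
    of any cycle of the class. *)
Definition hodge K : 'Hom(Hp R p K, chain R m) :=
  (proj_perp (B_ K) \o linfun (@vsval _ _ (Z_ K)) \o (cls R p K)^-1)%VF.

Lemma cls_surj K h : exists z, cls R p K z = h.
Proof. exact: subquo_pi_surj. Qed.

Lemma hodge_cls K z : hodge K (cls R p K z) = proj_perp (B_ K) (vsval z).
Proof.
rewrite /hodge !comp_lfunE lfunE /=.
apply/eqP; rewrite -subr_eq0 -linearB proj_perp_eq0 -cls_eq.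
apply/eqP/(@limg_lfunVK _ _ _ (cls R p K)); exact/memv_img/memvf.
Qed.

Lemma hodge_inj K : injective (hodge K).
Proof.
move=> g h; have [[x <-] [y <-]] := (cls_surj g, cls_surj h).
move/eqP; rewrite !hodge_cls -subr_eq0 -linearB proj_perp_eq0 => xy.
by apply/eqP; rewrite cls_eq.
Qed.

Lemma hodge_harm K (z : subvs_of (Z_ K)) :
  vsval z \in harm R p K -> hodge K (cls R p K z) = vsval z.
Proof. by rewrite hodge_cls memv_cap => /andP[_]; exact: proj_perp_id. Qed.

(** Projecting a cycle changes it by a boundary, and boundaries are cycles, so
    the result is harmonic; conversely a harmonic cycle is its own projection. *)
Lemma limg_hodge K : simplicial_complex K -> limg (hodge K) = harm R p K.
Proof.
move=> cK; apply/vspaceP => v; apply/memv_imgP/idP => [[h _ ->]|vH].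
  have [z <-] := cls_surj h; rewrite hodge_cls memv_cap proj_perp_mem andbT.
  rewrite -[X in X \in _](subKr (vsval z)) memvB ?subvsP //.
  exact/(subvP (Bp_sub_Zp _ _ cK))/sub_proj_perp.
have vZ : v \in Z_ K by move: vH; rewrite memv_cap => /andP[].
exists (cls R p K (vsproj (Z_ K) v)); first exact: memvf.
by rewrite hodge_harm ?vsprojK.
Qed.

(** Naturality: the projection of a cycle of K' along the boundaries of K' only
    removes a boundary of K, which the projection along the boundaries of K
    would have removed anyway. *)
Lemma hodge_imap K' K h : K' \subset K ->
  hodge K (imap R p K' K h) = proj_perp (B_ K) (hodge K' h).
Proof.
move=> sK; have [z <-] := cls_surj h.
have zK : vsval z \in Z_ K.
  exact: (subvP (capvS (Cp_sub _ _ sK) (subvv _))) (subvsP z).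
rewrite (imapE (z := vsproj (Z_ K) (vsval z))) ?vsprojK // !hodge_cls vsprojK //.
apply/eqP; rewrite -subr_eq0 -linearB proj_perp_eq0.
exact/(subvP (limgS _ (Cp_sub _ _ sK)))/sub_proj_perp.
Qed.

(** By naturality and injectivity of [hodge K], membership in the preimage can
    be tested on harmonic cycles. *)
Lemma hodge_preim_imap K' K X : simplicial_complex K' -> K' \subset K ->
  (hodge K' @: (imap R p K' K @^-1: X) =
   harm R p K' :&: proj_perp (B_ K) @^-1: (hodge K @: X))%VS.
Proof.
move=> cK' sK; apply/vspaceP => v; rewrite memv_cap -limg_hodge // -memv_preim.
apply/memv_imgP/andP => [[h hX ->]|[/memv_imgP[h _ ->]]].
  by rewrite memv_img ?memvf // -hodge_imap // memv_img // memv_preim.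
rewrite -hodge_imap // memv_limg_inj; last exact: hodge_inj.
by rewrite memv_preim; exists h.
Qed.

End Hodge.

(** * Harmonic versions of the persistence subspaces *)

Section HarmonicPersistence.
Variables (R : realType) (m : nat) (K : {set {set 'I_m.+1}}).
Variables (d : Order.disp_t) (T : orderType d) (F : filtration K T) (p : nat).
Implicit Types s t : T.

Lemma fsubx_complex (s' : option T) : simplicial_complex (fsubx F s').
Proof.
case: s' => [s'|] /=; first exact: fsub_complex.
by split=> [|x y]; rewrite ?inE.
Qed.

Lemma fsubx_sub (s' : option T) s t :
  ltx s' s -> (s <= t)%O -> fsubx F s' \subset F t.
Proof.
case: s' => [s'|] /= lt_s's le_st; last exact: finset.sub0set.
exact/fsub_mono/ltW/(lt_le_trans lt_s's).
Qed.

Lemma hodge_Him (s' : option T) s t : ltx s' s -> (s <= t)%O ->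
  (hodge R p (F t) @: Him R F p s' t)%VS = hHim R F p s' t.
Proof.
move=> lt_s's le_st; rewrite /hHim -(limg_hodge _ _ (fsubx_complex s')).
rewrite /Him -!limg_comp; apply: eq_in_limg => h _.
rewrite [LHS]comp_lfunE [RHS]comp_lfunE hodge_imap //.
exact: fsubx_sub le_st.
Qed.

Lemma hodge_preim_Him (s' : option T) s t : ltx s' s -> (s <= t)%O ->
  (hodge R p (F s) @: (imap R p (F s) (F t) @^-1: Him R F p s' t))%VS =
  hpre F p s t (hHim R F p s' t).
Proof.
move=> lt_s's le_st; rewrite hodge_preim_imap ?(hodge_Him lt_s's) //.
  exact: fsub_complex.
exact: fsub_mono.
Qed.

Lemma hodge_M s t : (s <= t)%O ->
  (hodge R p (F s) @: M_ R F p s t)%VS = hM R F p s t.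
Proof.
move=> le_st; rewrite /M_ limg_vsum; congr vsum; apply/funext => -[s' lt_s's].
exact: hodge_preim_Him.
Qed.

Lemma hodge_N s t : (hodge R p (F s) @: N_ R F p s t)%VS = hN R F p s t.
Proof.
rewrite /N_ limg_vsum; congr vsum.
apply/funext => -[[s' t'] /and3P[/= lt_s's le_st' _]].
exact: hodge_preim_Him.
Qed.

Lemma hodge_Moo s : (hodge R p (F s) @: Moo R F p s)%VS =
  vsum (fun t' : {t' : T | (s <= t')%O} => hM R F p s (sval t')).
Proof.
rewrite /Moo limg_vsum; congr vsum; apply/funext => -[t' le_st'].
exact: hodge_M.
Qed.

End HarmonicPersistence.

(** * Comparison of contents *)

Section Content.
Variables (R : realType) (m : nat).

Lemma Cp_supp p (K : {set {set 'I_m.+1}}) (v : chain R m) x :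
  v \in Cp R p K -> x \notin simplices p K -> v x = 0.
Proof.
move=> /memv_sumP[vs vsE ->] xK; rewrite sum_ffunE big1 // => y yK.
have /vlineP[k ->] := vsE y yK; rewrite !ffunE.
by case: eqP xK => [->|_ _]; [rewrite yK | exact: mulr0].
Qed.

Lemma dotp_simplices p (K : {set {set 'I_m.+1}}) (u v : chain R m) :
  u \in Cp R p K -> \sum_(x in simplices p K) u x * v x = dotp u v.
Proof.
move=> uK; rewrite /dotp [RHS](bigID (mem (simplices p K))) /=.
rewrite [X in _ + X]big1 ?addr0 // => x xK.
by rewrite (Cp_supp uK xK) mul0r.
Qed.

Variables (K : {set {set 'I_m.+1}}).
Variables (d : Order.disp_t) (T : orderType d) (F : filtration K T) (p : nat).
Variables (s : T) (t : option T).

(** The common form of the finite and the infinite case. Only one inclusion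
    between the set of representatives and the difference of A and N is assumed,
    because representatives are needed only as witnesses that a simplex is not
    essential. The cycle z ranges over all of A: if its class lies in N then
    k = 0, z vanishes on the essential simplices, and its content is zero. *)
Lemma content_le_rep (A N : {vspace Hp R p (F s)})
    (z0 z : subvs_of (Defs.Zp R p (F s))) :
  (forall x, cls R p (F s) x \in A -> cls R p (F s) x \notin N ->
     Rep F p s t (vsval x)) ->
  (forall u v, u \in A -> v \in A -> v \notin N ->
     exists k, u - k *: v \in N) ->
  vsval z0 != 0 -> vsval z0 \in perp (Bp R p (F s)) ->
  vsval z0 \in perp (hodge R p (F s) @: N)%VS ->
  cls R p (F s) z0 \in A -> cls R p (F s) z \in A ->
  content F p s t (vsval z) <= content F p s t (vsval z0).
Proof.
set c := cls R p (F s) => RepAN codimN z0_neq0 z0B z0N z0A zA.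
have z0_notN : c z0 \notin N.
  apply/negP => /(memv_img (hodge R p (F s))); rewrite hodge_cls proj_perp_id //.
  move=> /(mem_orthovP z0N) /= z0z0.
  by have := dotp_gt0 z0_neq0; rewrite z0z0 ltxx.
have [k zkN] := codimN _ _ zA z0A z0_notN.
have [y [yN yA zE]] : exists y : subvs_of (Defs.Zp R p (F s)),
    [/\ c y \in N, c y \in A & vsval z = k *: vsval z0 + vsval y].
  exists (z - k *: z0); split.
  - by rewrite linearB linearZ.
  - by rewrite linearB linearZ /= memvB // memvZ.
  - by rewrite linearB linearZ /= [RHS]addrC scalerN subrK.
have y_ess x : x \in essential R F p s t -> vsval y x = 0.
  rewrite inE => /andP[_ /asboolP x_ess]; apply: contraTeq isT => yx.
  (* The multiple of y is chosen to cancel the coefficient of x in z0. *)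
  pose w := z0 - (vsval z0 x / vsval y x) *: y.
  have wA : c w \in A by rewrite linearB linearZ /= memvB // memvZ.
  have wN : c w \notin N.
    apply: contra z0_notN => wN.
    have := memvD wN (memvZ (vsval z0 x / vsval y x) yN).
    by rewrite -linearZ -linearD subrK.
  have := x_ess _ (RepAN w wA wN); rewrite inE => /andP[_].
  by rewrite linearB linearZ !ffunE /= scalerN [_ *: _]divfK // subrr eqxx.
(* Projecting y along the boundaries changes neither its product with z0 nor
   its class. *)
have z0y : dotp (vsval z0) (vsval y) = 0.
  rewrite -(dotp_proj_perp _ z0B) -hodge_cls.
  exact: (mem_orthovP z0N) _ (memv_img _ yN).
have sumE (u : subvs_of (Defs.Zp R p (F s))) :
    \sum_(x in simplices p K) vsval u x ^+ 2 = dotp (vsval u) (vsval u).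
  apply: dotp_simplices; have := subvsP u; rewrite memv_cap => /andP[uC _].
  exact: subvP (Cp_sub _ _ (fsub_sub F s)) _ uC.
set e := \sum_(x in essential R F p s t) vsval z0 x ^+ 2.
have essE : \sum_(x in essential R F p s t) vsval z x ^+ 2 = k ^+ 2 * e.
  rewrite mulr_sumr; apply: eq_bigr => x /y_ess yx.
  by rewrite zE !ffunE yx addr0 exprMn.
have normE : dotp (vsval z) (vsval z) =
    k ^+ 2 * dotp (vsval z0) (vsval z0) + dotp (vsval y) (vsval y).
  rewrite zE !(linearDl, linearDr, linearZl_LR, linearZr_LR) /=.
  by rewrite z0y (dotpC (vsval y)) z0y !mulr0 addr0 add0r mulrA.
have z0_gt0 := dotp_gt0 z0_neq0.
have y_ge0 : 0 <= dotp (vsval y) (vsval y).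
  by apply: sumr_ge0 => x _; rewrite -expr2 sqr_ge0.
have e_ge0 : 0 <= e by apply: sumr_ge0 => x _; exact: sqr_ge0.
rewrite /content; apply: ler_wsqrtr; rewrite essE !sumE.
(* The content of the zero chain is 0 / 0 = 0. *)
have [->|z_neq0] := eqVneq (vsval z) 0.
  by rewrite [dotp 0 0]linear0l invr0 mulr0 divr_ge0 // ltW.
rewrite ler_pdivrMr ?dotp_gt0 // -/e [leRHS]mulrAC ler_pdivlMr //.
have -> : k ^+ 2 * e * dotp (vsval z0) (vsval z0) =
    e * (k ^+ 2 * dotp (vsval z0) (vsval z0)) by rewrite -mulrA mulrCA.
by rewrite ler_wpM2l // normE lerDl.
Qed.

End Content.

Theorem theorem4p8 (R : realType) (m : nat) (K : {set {set 'I_m.+1}})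
    (HK : simplicial_complex K) (d : Order.disp_t) (T : orderType d)
    (F : filtration K T) (p : nat) (s : T) (t : option T)
    (Hb : barcode R F p (s, t, 1%N))
    (z0 : chain R m) (Hz0 : harmonic_rep F p s t z0)
    (z : chain R m) (Hz : Rep F p s t z) :
  content F p s t z <= content F p s t z0.
Proof.
have [lt_st mu1] : lt_end s t /\ mu R F p s t = 1%N.
  by case: Hb => s' [t' [lt_st _ [-> -> <-]]].
have [z0_neq0 z0P] := Hz0.
have harm_lift v : v \in harm R p (F s) ->
    exists2 x : subvs_of (Defs.Zp R p (F s)),
      v = vsval x & v \in perp (Bp R p (F s)).
  by rewrite memv_cap => /andP[vZ vB]; exists (vsproj _ v) => //; rewrite vsprojK.
case: t lt_st mu1 Hz z0P {Hb Hz0} => [t|] lt_st mu1 Hz z0P.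
- have [[x xM zE] _] := Hz.
  move: z0P; rewrite /hP /= memv_cap => /andP[].
  rewrite -(hodge_M R F p (ltW lt_st)) -hodge_N => z0M z0N.
  have z0H : z0 \in harm R p (F s).
    rewrite -limg_hodge; last exact: fsub_complex.
    exact: subvP (limgS _ (subvf _)) _ z0M.
  have [x0 z0E z0B] := harm_lift _ z0H.
  rewrite -zE; rewrite {}z0E in z0_neq0 z0M z0N z0H z0B *.
  rewrite -(hodge_harm z0H) memv_limg_inj in z0M; last exact: hodge_inj.
  apply: (@content_le_rep _ _ _ _ _ _ _ _ _ (M_ R F p s t) (N_ R F p s t)) => //.
    move=> w wM wN; split; first by exists w.
    by move=> [w' w'N /subvs_inj ww']; move: wN; rewrite -ww' => /negP; apply.
  by move=> u v uM vM; exact: subquo_dim1 mu1 uM vM.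
- case: z0P => /= z0H z0M; case: Hz => /= zZ _.
  have [x0 z0E z0B] := harm_lift _ z0H; rewrite -(vsprojK zZ).
  rewrite {}z0E in z0_neq0 z0M z0H z0B *.
  have z0N : vsval x0 \in perp (hodge R p (F s) @: Moo R F p s)%VS.
    rewrite hodge_Moo mem_orthov_sym; apply: vsum_sub => -[t le_st] /=.
    by rewrite -mem_orthov_sym; exact: z0M.
  apply: (@content_le_rep _ _ _ _ _ _ _ _ _ fullv (Moo R F p s)) => //;
    rewrite ?memvf //.
    move=> w _ wN; split=> [|[t le_st [w' w'M /subvs_inj ww']]].
      exact: subvsP.
    move: wN; rewrite -ww' => /negP; apply.
    exact: (memv_vsum (i := exist _ t le_st)).
  by move=> u v _ _; exact: vquot_dim1 mu1.
Qed.
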